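(* Let $D$ be a dendrite, let $f\colon D\to D$ be a totally transitive continuous map, and suppose that $\mathrm{Per}(f)\setminus \mathrm{End}(D)$ is dense in $D$. Then $f$ is mixing.
   Context: A continuum is a compact, connected, nonempty metric space. A dendrite is a continuum $D$ in which any two distinct points can be separated by a third point of $D$. A point of $D$ is an endpoint if it has order $1$, i.e. it has arbitrarily small open neighborhoods with one-point boundary; $\mathrm{End}(D)$ is the set of endpoints. $\mathrm{Per}(f)$ is the set of periodic points of $f$, i.e. points $x$ with $f^n(x)=x$ for some $n>0$. A continuous map $f\colon X\to X$ of a compact metric space is transitive if for all nonempty open $U,V\subset X$ there is $n>0$ with $f^n(U)\cap V\neq\emptyset$; totally transitive if $f^n$ is transitive for all $n\ge 1$; mixing if for all nonempty open $U,V\subset X$ there is $N>0$ with $f^n(U)\cap V\ne\emptyset$ for all $n\ge N$. *)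

(* Defs.v *)
From mathcomp Require Import all_boot all_order all_algebra.
From mathcomp Require Import all_classical all_reals all_analysis.

Set Implicit Arguments.
Unset Strict Implicit.
Unset Printing Implicit Defensive.

Local Open Scope classical_set_scope.

Definition continuum (R : realType) (D : metricType R) : Prop :=
  [/\ [set: D] !=set0, compact [set: D] & connected [set: D]].

Definition separates (T : topologicalType) (z x y : T) : Prop :=
  exists A B : set T,
    [/\ A x, B y, separated A B & A `|` B = [set~ z]].

(* That z is a third point, distinct from x and y, is part of [separates]:
   x and y lie in A `|` B = [set~ z]. *)
Definition dendrite (R : realType) (D : metricType R) : Prop :=
  continuum D /\ forall x y : D, x <> y -> exists z : D, separates z x y.

Definition boundary (T : topologicalType) (A : set T) : set T :=
  closure A `\` interior A.

Definition endpoints (T : topologicalType) : set T :=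
  [set x | forall W : set T, nbhs x W ->
     exists U : set T, [/\ open U, U x, U `<=` W &
                           exists b : T, boundary U = [set b]]].
Arguments endpoints T : clear implicits.

Definition periodic_points (T : Type) (f : T -> T) : set T :=
  [set x | exists n : nat, (0 < n)%N /\ iter n f x = x].

Definition topologically_transitive (T : topologicalType) (f : T -> T) : Prop :=
  forall U V : set T, open U -> U !=set0 -> open V -> V !=set0 ->
    exists n : nat, (0 < n)%N /\ (iter n f @` U) `&` V !=set0.

Definition totally_transitive (T : topologicalType) (f : T -> T) : Prop :=
  forall n : nat, (1 <= n)%N -> topologically_transitive (iter n f).

Definition topologically_mixing (T : topologicalType) (f : T -> T) : Prop :=
  forall U V : set T, open U -> U !=set0 -> open V -> V !=set0 ->
    exists N : nat, (0 < N)%N /\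
      forall n : nat, (N <= n)%N -> (iter n f @` U) `&` V !=set0.

(* Main.v *)
Require Import Defs.
From mathcomp Require Import all_boot all_order all_algebra.
From mathcomp Require Import all_classical all_reals all_analysis.

Local Open Scope classical_set_scope.

(** Given open [U] and [V], pick a periodic [p] in [U] and a periodic [q] in [V]
    that is not an endpoint, both fixed by [g = iter m f].  A point of order
    greater than 1 cuts the dendrite, so the complement of [q] splits into
    nonempty open [A] and [B], and some connected neighbourhood [C] of [p] lies
    in [U].  For each residue [r] modulo [m], the connected sets
    [iter (m * j + r) f @` C] all contain [iter r f p]; if this point lies in
    [A], transitivity of [g] makes one of these sets meet [B], hence contain
    [q].  As [q] is fixed by [g], so do all later ones, and finitely many
    residues give a uniform bound. *)

(** * Compactness as an induction principle, and separated sets *)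

Lemma setI_eq0_absurd {T : Type} {A B : set T} {x : T} :
  A `&` B = set0 -> A x -> B x -> False.
Proof. by move=> AB Ax Bx; have : (A `&` B) x by []; rewrite AB. Qed.

(** If [P F] failed, the sets [S] with [P (F \ S)] would form a proper filter containing [F]. A
    neighbourhood with [P] of a cluster point in [F] has its complement in that filter, which is
    absurd. *)
Lemma compact_ind {T : topologicalType} {F : set T} (P : set T -> Prop) :
  compact F -> P set0 ->
  (forall A B, A `<=` B -> P B -> P A) ->
  (forall A B, P A -> P B -> P (A `|` B)) ->
  (forall x, F x -> exists2 W, nbhs x W & P W) ->
  P F.
Proof.
move=> cF P0 Psub PU Ploc; apply: contrapT => nPF.
pose G : set_system T := [set S | P (F `\` S)].
have G_proper : ProperFilter G.
  split.
    by rewrite /G /= setD0.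
  split.
  - by rewrite /G /= setDT.
  - by move=> A B GA GB; rewrite /G /= setDIr; exact: PU.
  - by move=> A B AB; apply: Psub => x [Fx nBx]; split=> // /AB.
have GF : G F by rewrite /G /= setDv.
have [x [Fx clx]] := cF G G_proper GF.
have [W xW PW] := Ploc x Fx.
have GW : G (~` W) by apply: Psub PW => y [_ /contrapT].
by have [y []] := clx _ _ GW xW.
Qed.

Lemma disjoint_open_separated {T : topologicalType} {A B : set T} :
  open A -> open B -> A `&` B = set0 -> separated A B.
Proof.
move=> oA oB /disjoints_subset AB; split; apply/seteqP; split=> // x [].
- move=> clA Bx; have [y [Ay By]] := clA B (open_nbhs_nbhs (conj oB Bx)).
  by have := AB y Ay.
- move=> Ax clB; have [y [By Ay]] := clB A (open_nbhs_nbhs (conj oA Ax)).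
  by have := AB y Ay.
Qed.

(** * Cuts of a space at a point *)

Definition cutting {T : topologicalType} (z : T) (A B : set T) : Prop :=
  [/\ open A, open B, A `&` B = set0 & A `|` B = [set~ z]].

Lemma cuttingC {T : topologicalType} {z : T} {A B : set T} :
  cutting z A B -> cutting z B A.
Proof. by case=> oA oB AB ABz; split=> //; rewrite 1?setIC 1?setUC. Qed.

(** Each side is the complement of [z] minus the closure of the other side, hence open since points
    are closed. *)
Lemma separated_cutting {T : topologicalType} {z : T} {A B : set T} :
  accessible_space T -> separated A B -> A `|` B = [set~ z] -> cutting z A B.
Proof.
move=> accT [clAB AclB] ABz.
have nzz : ~ [set~ z] z by apply.
have nAz : ~ A z by move=> Az; apply: nzz; rewrite -ABz; left.
have nBz : ~ B z by move=> Bz; apply: nzz; rewrite -ABz; right.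
have AE : A = [set~ z] `&` ~` closure B.
  apply/seteqP; split=> x.
    move=> Ax; split=> [xz|clBx]; first by apply: nAz; rewrite -xz.
    by have : (A `&` closure B) x by []; rewrite AclB.
  by rewrite -ABz => -[[//|Bx] nclB]; case: nclB; exact: subset_closure.
have BE : B = [set~ z] `&` ~` closure A.
  apply/seteqP; split=> x.
    move=> Bx; split=> [xz|clAx]; first by apply: nBz; rewrite -xz.
    by have : (closure A `&` B) x by []; rewrite clAB.
  by rewrite -ABz => -[[Ax|//] nclA]; case: nclA; exact: subset_closure.
have oz : open [set~ z] by apply: closed_openC; exact: accessible_closed_set1.
split=> //.
- by rewrite AE; apply: openI => //; apply: closed_openC; exact: closed_closure.
- by rewrite BE; apply: openI => //; apply: closed_openC; exact: closed_closure.
- by apply/seteqP; split=> // x [Ax Bx]; rewrite -AclB; split=> //;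
    exact: subset_closure.
Qed.

Lemma cutting_closed {T : topologicalType} {z : T} {A B : set T} :
  cutting z A B -> closed (A `|` [set z]).
Proof.
case=> oA oB AB ABz; rewrite (_ : _ `|` _ = ~` B); first exact: open_closedC.
apply/seteqP; split=> x.
  move=> [Ax Bx|->{x} Bz]; first by have : (A `&` B) x by []; rewrite AB.
  by have /(_ erefl) : [set~ z] z by rewrite -ABz; right.
move=> nBx; have [->|xz] := pselect (x = z); first by right.
by have : [set~ z] x by []; rewrite -ABz => -[]; left.
Qed.

Lemma connected_cutting {T : topologicalType} {z : T} {A B K : set T} :
  cutting z A B -> connected K -> ~ K z -> K `<=` A \/ K `<=` B.
Proof.
case=> oA oB AB ABz cK nKz.
apply: connected_subset cK; first exact: disjoint_open_separated.
by rewrite ABz => x Kx xz; apply: nKz; rewrite -xz.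
Qed.

Lemma connected_cutting_mem {T : topologicalType} {z a b : T} {A B K : set T} :
  cutting z A B -> connected K -> K a -> K b -> A a -> B b -> K z.
Proof.
move=> cutz cK Ka Kb Aa Bb; apply: contrapT => nKz.
have [_ _ AB _] := cutz.
case: (connected_cutting cutz cK nKz) => KS.
  by case: (setI_eq0_absurd AB (x := b)) => //; exact: KS.
by case: (setI_eq0_absurd AB (x := a)) => //; exact: KS.
Qed.

(* A separation of [K `&` (A `|` [set z])] becomes one of [K] when [K `&` B]
   is added to the part that contains [z]. *)
Lemma connected_cuttingI {T : topologicalType} {z p : T} {A B K : set T} :
  cutting z A B -> connected K -> K p -> A p -> connected (K `&` (A `|` [set z])).
Proof.
move=> cutz cK Kp Ap; have [oA oB AB ABz] := cutz.
have [Kz|nKz] := pselect (K z); last first.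
  rewrite setIidl //.
  case: (connected_cutting cutz cK nKz) => KS x Kx; first by left; exact: KS.
  by case: (setI_eq0_absurd AB (x := p)) => //; exact: KS.
have [clAB AclB] := disjoint_open_separated oA oB AB.
(* Here [E0] is the part containing [z]. So [E1] misses [z] and lies in [A], away from the trace of
   [K] on [B]. The enlarged separation of [K] then fails at [e] or at [z]. *)
have key E0 E1 : E0 `|` E1 = K `&` (A `|` [set z]) -> separated E0 E1 ->
    E1 !=set0 -> E0 z -> False.
  move=> EU [cE E01] [e E1e] E0z.
  have E1A : E1 `<=` A.
    move=> x E1x; have : (E0 `|` E1) x by right.
    rewrite EU => -[_ [//|xz]]; exfalso.
    by apply: (setI_eq0_absurd cE _ E1x); apply: subset_closure; rewrite xz.
  have : K `<=` E0 `|` (K `&` B) \/ K `<=` E1.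
    apply: connected_subset cK.
      split; apply/seteqP; split=> // x [].
        rewrite closureU => -[clx|clx] E1x; first by rewrite -cE.
        have : (A `&` closure B) x.
          by split; [exact: E1A|apply: closure_subset clx => y []].
        by rewrite AclB.
      move=> [E0x|[_ Bx]] clx; first by rewrite -E01.
      have : (closure A `&` B) x by split=> //; apply: closure_subset clx.
      by rewrite clAB.
    move=> x Kx; have [xz|xz] := pselect (x = z).
      by left; left; rewrite xz.
    have : [set~ z] x by []; rewrite -ABz => -[Ax|Bx]; last by left; right.
    have : (E0 `|` E1) x by rewrite EU; split=> //; left.
    by move=> [|]; [left; left|right].
  case=> KS; last first.
    have E1z := KS z Kz.
    by case: (setI_eq0_absurd cE (x := z)) => //; exact: subset_closure.
  have [Ke _] : (K `&` (A `|` [set z])) e by rewrite -EU; right.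
  case: (KS e Ke) => [E0e|[_ Be]].
    by case: (setI_eq0_absurd cE (x := e)) => //; exact: subset_closure.
  by case: (setI_eq0_absurd AB (x := e)) => //; exact: E1A.
apply: contrapT => /connectedPn [E [E0 EU Esep]].
have : (K `&` (A `|` [set z])) z by split=> //; right.
rewrite EU => -[Ez|Ez].
  by apply: (key (E false) (E true)).
apply: (key (E true) (E false)) => //; first by rewrite setUC.
by case: Esep => ? ?; split; rewrite setIC.
Qed.

(** * Point separation and closed connected neighbourhoods *)

Definition point_separated (T : topologicalType) : Prop :=
  forall x y : T, x <> y -> exists (z : T) (A B : set T),
    [/\ cutting z A B, A x & B y].

Lemma dendrite_point_separated {R : realType} {D : metricType R} :
  dendrite D -> point_separated D.
Proof.
move=> [_ sepD] x y xy; have [z [A [B [Ax By sAB ABz]]]] := sepD x y xy.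
exists z, A, B; split=> //; apply: separated_cutting => //.
exact/hausdorff_accessible/metric_hausdorff.
Qed.

(* By compactness, finitely many cuts separate [p] from the complement of [W];
   intersecting the closed sides that contain [p] keeps connectedness. *)
Lemma closed_connected_nbhs {T : topologicalType} {p : T} {W : set T} :
  compact [set: T] -> connected [set: T] -> point_separated T -> nbhs p W ->
  exists C, [/\ closed C, connected C, nbhs p C & C `<=` W].
Proof.
move=> compT connT sepT pW.
have [U [oU Up] UW] : exists2 U, open_nbhs p U & U `<=` W by move: pW; rewrite nbhsE.
(* Quantifying over every starting [K] lets cuts be made in succession: for a union, the set
   obtained for [A] is the start for [B]. *)
pose P (S : set T) := forall K, closed K -> connected K -> nbhs p K ->
  exists C, [/\ closed C, connected C, nbhs p C, C `<=` K & C `&` S = set0].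
have PU : P (~` U).
  apply: compact_ind.
  - apply: subclosed_compact compT _ => //; exact: open_closedC.
  - by move=> K clK cK pK; exists K; split=> //; rewrite setI0.
  - move=> A B AB PB K clK cK pK; have [C [? ? ? ? CB]] := PB K clK cK pK.
    exists C; split=> //; apply/seteqP; split=> // x [Cx Ax].
    by rewrite -CB; split=> //; exact: AB.
  - move=> A B PA PB K clK cK pK.
    have [C [clC cC pC CK CA]] := PA K clK cK pK.
    have [C' [clC' cC' pC' CC' CB]] := PB C clC cC pC.
    exists C'; split=> //; first exact: subset_trans CK.
    rewrite setIUr CB setU0; apply/seteqP; split=> // x [/CC' Cx Ax].
    by rewrite -CA.
  - move=> y nUy; have py : p <> y by move=> py; apply: nUy; rewrite -py.
    have [z [A [B [cutz Ap By]]]] := sepT p y py.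
    have [oA oB AB ABz] := cutz.
    exists B; first exact: open_nbhs_nbhs.
    move=> K clK cK pK; exists (K `&` (A `|` [set z])); split.
    + by apply: closedI => //; exact: cutting_closed cutz.
    + exact: connected_cuttingI cutz cK (nbhs_singleton pK) Ap.
    + apply: filterI => //; apply: filterS (open_nbhs_nbhs (conj oA Ap)).
      by move=> x; left.
    + by move=> x [].
    + apply/seteqP; split=> // x [[_ [Ax|xz]] Bx]; first by rewrite -AB.
      have : [set~ z] x by rewrite -ABz; right.
      by apply.
have [C [clC cC pC _ CU]] := PU setT closedT connT filterT.
exists C; split=> // x Cx; apply: UW; apply: contrapT => nUx.
by have : (C `&` ~` U) x by []; rewrite CU.
Qed.

(* Linking points through closed connected neighbourhoods is an equivalence
   relation with open classes. *)
Lemma closed_connected_joining {T : topologicalType} {O : set T} {x : T} :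
  open O -> connected O ->
  (forall y, O y -> exists C, [/\ closed C, connected C, nbhs y C & C `<=` O]) ->
  O x -> forall y, O y ->
  exists K, [/\ closed K, connected K, K x, K y & K `<=` O].
Proof.
move=> oO cO locO Ox.
pose S := [set y | O y /\
  exists K, [/\ closed K, connected K, K x, K y & K `<=` O]].
(* This one step gives both that [S] is open and that it is closed in [O]. *)
have link y C : O y -> closed C -> connected C -> C `<=` O -> C y ->
    forall w, C w -> S w -> S y.
  move=> Oy clC cC CO Cy w Cw [_ [K [clK cK Kx Kw KO]]]; split=> //.
  exists (K `|` C); split; [exact: closedU| |by left|by right|].
    by apply: connectedU => //; exists w.
  by move=> v [/KO|/CO].
have SO : S = O.
  apply: cO.
  - have [C [clC cC xC CO]] := locO x Ox; have Cx := nbhs_singleton xC.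
    by exists x; split=> //; exists C.
  - exists S; last by apply/seteqP; split=> [y [Oy ?]|y []].
    rewrite openE => y Sy; have [Oy _] := Sy.
    have [C [clC cC yC CO]] := locO y Oy.
    have Cy := nbhs_singleton yC; apply: filterS yC => w Cw.
    exact: (link w C (CO w Cw) clC cC CO Cw y).
  - exists (closure S); first exact: closed_closure.
    apply/seteqP; split=> [y Sy|y [Oy clSy]].
      by split; [case: Sy|exact: subset_closure].
    have [C [clC cC yC CO]] := locO y Oy.
    have [w [Sw Cw]] := clSy C yC.
    exact: (link y C Oy clC cC CO (nbhs_singleton yC) w).
by move=> y Oy; have [] : S y by rewrite SO.
Qed.

(** * Points that do not cut are endpoints *)

(* Enclose [~` W] in a closed connected [K] avoiding [q]. The component of
   [~` K] at [q] has a single boundary point: a point cutting two boundary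
   points apart would lie both in [K] and in the component. *)
Lemma noncut_endpoint {T : topologicalType} {q y0 : T} :
  compact [set: T] -> connected [set: T] -> accessible_space T ->
  point_separated T -> connected [set~ q] -> y0 <> q -> endpoints T q.
Proof.
move=> compT connT accT sepT cq y0q W qW.
have oq : open [set~ q] by apply: closed_openC; exact: accessible_closed_set1.
have locq y : [set~ q] y ->
    exists C, [/\ closed C, connected C, nbhs y C & C `<=` [set~ q]].
  by move=> yq; apply: closed_connected_nbhs => //; exact: open_nbhs_nbhs.
have join := closed_connected_joining oq cq locq y0q.
have [U [oU Uq] UW] : exists2 U, open_nbhs q U & U `<=` W by move: qW; rewrite nbhsE.
have [K [clK cK Ky0 KU nKq]] : exists K, [/\ closed K, connected K, K y0,
    ~` U `<=` K & ~ K q].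
  (* All enclosing sets share [y0], so their unions stay connected. *)
  apply: (@compact_ind _ (~` U) (fun S => exists K,
    [/\ closed K, connected K, K y0, S `<=` K & ~ K q])).
  - apply: subclosed_compact compT _ => //; exact: open_closedC.
  - have [K [clK cK Ky0 _ Kq]] := join y0 y0q.
    exists K; split=> //; by move=> /Kq/(_ erefl).
  - move=> A B AB [K [clK cK Ky0 BK nKq]].
    by exists K; split=> //; exact: subset_trans BK.
  - move=> A B [K [clK cK Ky0 AK nKq]] [L [clL cL Ly0 BL nLq]].
    exists (K `|` L); split; [exact: closedU| |by left|exact: setUSS|by case].
    by apply: connectedU => //; exists y0.
  - move=> x nUx; have xq : [set~ q] x by move=> xq; apply: nUx; rewrite xq.
    have [C [clC cC xC Cq]] := locq x xq.
    have [K [clK cK Ky0 Kx Kq]] := join x xq.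
    exists C => //; exists (K `|` C); split; [exact: closedU| |by left|by right|].
      by apply: connectedU => //; exists x; split=> //; exact: nbhs_singleton.
    by case=> [/Kq|/Cq]; apply.
pose C := connected_component (~` K) q.
have CK : C `<=` ~` K by exact: connected_component_sub.
have cC : connected C by exact: component_connected.
have Cq : C q by exact: connected_component_refl.
(* Near a point outside [K], membership in [C] is locally constant. Hence [C] is open and its
   boundary lies in [K]. *)
have absorb x : ~ K x -> exists2 N, nbhs x N &
    forall w, N w -> C w -> N `<=` C.
  move=> nKx; have oK : open (~` K) by exact: closed_openC.
  have [N [_ cN xN NK]] := closed_connected_nbhs compT connT sepT
    (open_nbhs_nbhs (conj oK nKx)).
  exists N => // w Nw Cw; rewrite /C (same_connected_component Cw).
  exact: connected_component_max.
have oC : open C.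
  rewrite openE => x Cx; have [N xN NC] := absorb x (CK x Cx).
  by apply: filterS (xN); apply: NC Cx; exact: nbhs_singleton.
have bdK x : closure C x -> ~ C x -> K x.
  move=> clx nCx; apply: contrapT => nKx.
  have [N xN NC] := absorb x nKx; have [w [Cw Nw]] := clx N xN.
  by apply: nCx; apply: (NC w) => //; exact: nbhs_singleton.
exists C; split=> //.
  by move=> x Cx; apply: UW; apply: contrapT => /KU; exact: CK.
rewrite /boundary (interior_id C).1 //.
(* Without boundary, [C] would be clopen, hence the whole space, although [y0] lies in [K]. *)
have [b [clb nCb]] : (closure C `\` C) !=set0.
  apply: contrapT => nbd.
  have CT : C = setT.
    apply: connT; first by exists q.
    - by exists C => //; rewrite setTI.
    - exists (closure C); first exact: closed_closure.
      rewrite setTI; apply/seteqP; split; first exact: subset_closure.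
      by move=> x clx; apply: contrapT => nCx; apply: nbd; exists x.
  by apply: (CK y0) => //; rewrite CT.
exists b; apply/seteqP; split=> [a [cla nCa]|x ->] //.
apply: contrapT => ab; have [z [A [B [cutz Aa Bb]]]] := sepT a b ab.
have [oA oB _ _] := cutz.
have [u [Cu Au]] := cla A (open_nbhs_nbhs (conj oA Aa)).
have [v [Cv Bv]] := clb B (open_nbhs_nbhs (conj oB Bb)).
have Cz : C z by exact: (connected_cutting_mem cutz cC Cu Cv Au Bv).
apply: (CK z Cz).
by apply: connected_cutting_mem cutz cK _ _ Aa Bb; exact: bdK.
Qed.

Lemma nonendpoint_cutting {R : realType} {D : metricType R} {q y0 : D} :
  dendrite D -> ~ endpoints D q -> y0 <> q ->
  exists A B, [/\ cutting q A B, A !=set0 & B !=set0].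
Proof.
move=> dD qE y0q; have sepD := dendrite_point_separated dD.
have [[_ compD connD] _] := dD.
have accD : accessible_space D.
  exact/hausdorff_accessible/metric_hausdorff.
have : ~ connected [set~ q].
  by move=> cq; apply: qE; apply: noncut_endpoint y0q.
move=> /connectedPn [E [E0 qE01 Esep]].
by exists (E false), (E true); split=> //; exact: separated_cutting.
Qed.

(** * Iterates, and orbits that cross a cut *)

Lemma iter_continuous {T : topologicalType} {f : T -> T} :
  continuous f -> forall n, continuous (iter n f).
Proof.
move=> cf; elim=> [|n IHn] x; first exact: cvg_id.
by apply: continuous_comp; [exact: IHn|exact: cf].
Qed.

(** Transitivity from [V] to itself gives a point of [V] in the image of [f], so preimages of
    nonempty open sets stay nonempty; induct on [r]. *)
Lemma transitive_iter_nonempty {T : topologicalType} {f : T -> T} :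
  continuous f -> topologically_transitive f ->
  forall (r : nat) (V : set T), open V -> V !=set0 ->
  iter r f @^-1` V !=set0.
Proof.
move=> cf tf; elim=> [//|r IHr] V oV V0.
apply: (IHr (f @^-1` V)); first by apply: open_comp => // x _; exact: cf.
have [n [n0 [_ [[x _ <-] Vx]]]] := tf V V oV V0 oV V0.
by exists (iter n.-1 f x); rewrite /= -iterS prednK.
Qed.

(* Along the residue class of [r], the connected image of [C] always contains
   [iter r f p]; transitivity of [iter m f] pushes it across the cut at [q]. *)
Lemma cutting_hit {T : topologicalType} {f : T -> T} {m : nat} {p q : T}
    {A B C : set T} (r : nat) :
  continuous f -> topologically_transitive f ->
  topologically_transitive (iter m f) -> iter m f p = p ->
  cutting q A B -> A !=set0 -> B !=set0 ->
  connected C -> nbhs p C ->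
  exists j x, C x /\ iter (m * j + r) f x = q.
Proof.
move=> cf tf tmf mp cutq A0 B0 cC pC.
have cross A' B' : cutting q A' B' -> B' !=set0 -> A' (iter r f p) ->
    exists j x, C x /\ iter (m * j + r) f x = q.
  move=> cutq' B'0 A'p; have [oA' oB' _ _] := cutq'.
  have oB'' : open (iter r f @^-1` B').
    by apply: open_comp => // x _; exact: iter_continuous.
  (* The target is pulled back by [iter r f], so that returns under [iter m f] land in the residue
     class of [r]. *)
  have [|j [_ [_ [[x Cx <-] B'x]]]] := tmf _ _ (open_interior C) _ oB''
    (transitive_iter_nonempty cf tf r _ oB' B'0); first by exists p.
  have {}Cx : C x := interior_subset Cx.
  exists j; suff [x0 Cx0 <-] : (iter (m * j + r) f @` C) q by exists x0.
  apply: connected_cutting_mem cutq' _ _ _ A'p _.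
  - apply: connected_continuous_connected => //.
    by apply: continuous_subspaceT; exact: iter_continuous.
  - exists p; first exact: nbhs_singleton.
    by rewrite addnC iterD mulnC iterM (iter_fix _ mp).
  - by exists x => //.
  - by rewrite addnC iterD mulnC iterM.
have [rq|rq] := pselect (iter r f p = q).
  by exists 0%N, p; rewrite muln0; split=> //; exact: nbhs_singleton.
have [_ _ _ ABq] := cutq.
have : [set~ q] (iter r f p) by [].
rewrite -ABq => -[Ap|Bp]; first exact: cross cutq B0 Ap.
exact: cross (cuttingC cutq) A0 Bp.
Qed.

Theorem theorem4p6 (R : realType) (D : metricType R) (f : D -> D)
  (hD : dendrite D) (hf : continuous f) (htt : totally_transitive f)
  (hper : dense (periodic_points f `\` endpoints D)) :
  topologically_mixing f.
Proof.
move=> U V oU U0 oV V0.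
have [p [Up [[k [k0 kp]] _]]] := hper U U0 oU.
have [q [Vq [[m [m0 mq]] qE]]] := hper V V0 oV.
(* In a one-point space no cut exists, but mixing is immediate. *)
have [[y0 y0q]|alone] := pselect (exists y, y <> q); last first.
  have all_q y : y = q by apply: contrapT => yq; apply: alone; exists y.
  exists 1%N; split=> // n _; exists q; split=> //.
  by exists p => //; exact: all_q.
have [[_ compD connD] _] := hD.
have [A [B [cutq A0 B0]]] := nonendpoint_cutting hD qE y0q.
have [C [_ cC pC CU]] := closed_connected_nbhs compD connD
  (dendrite_point_separated hD) (open_nbhs_nbhs (conj oU Up)).
have km0 : (0 < k * m)%N by rewrite muln_gt0 k0.
have kmp : iter (k * m) f p = p by rewrite mulnC iterM iter_fix.
have kmq : iter (k * m) f q = q by rewrite iterM iter_fix.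
(* At exponent 1, [htt] is transitivity of [f] itself; [k * m] is a common period of [p] and [q]. *)
have hit r := cutting_hit r hf (htt 1%N isT) (htt _ km0) kmp cutq A0 B0 cC pC.
have [j hj] := choice hit.
(* [N] bounds the quotients [j r] over all residues; the successor keeps the threshold [k * m * N]
   positive. *)
pose N := (\max_(r < k * m) j r).+1.
exists (k * m * N)%N; split; first by rewrite muln_gt0 km0.
move=> n nN; pose r := (n %% (k * m))%N; pose d := (n %/ (k * m))%N.
have rkm : (r < k * m)%N by rewrite ltn_mod.
have jd : (j r <= d)%N.
  have Nd : (N <= d)%N by rewrite leq_divRL // mulnC.
  apply: leq_trans Nd; apply: leqW.
  exact: (@leq_bigmax _ (fun i : 'I_(k * m) => j i) (Ordinal rkm)).
have [x [Cx xq]] := hj r.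
exists q; split=> //; exists x; first exact: CU.
(* Split [n] as [(d - j r) * (k * m)] plus [k * m * j r + r]: the second part sends [x] to [q], and
   the first fixes [q]. *)
rewrite (divn_eq n (k * m)) -/r -/d -(subnK jd) mulnDl -addnA [(j r * _)%N]mulnC.
by rewrite iterD xq iterM iter_fix.
Qed.
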